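(* Let $X, Y$ be non-zero ordered normed spaces with the following properties: (1) The cone $X_+$ is total, there exists an equivalent norm on $X$ that is additive on $X_+$, and every extremal vector of $X_+$ is also extremal in the bidual cone $X''_+$ (where $X$ is identified with its canonical image in $X''$). Moreover, the convex hull of the extremal vectors in $X_+$ is dense in $X_+$. (2) The cone $Y_+$ has non-empty interior. For an interior point $y_0$ of $Y_+$ and an interior point $x_0'$ of $X'_+$, define the subset $$S' := \big\{ y' \otimes x : x \text{ is extremal in } X_+,\ y' \text{ is extremal in } Y'_+, \text{ and } \langle y', y_0\rangle \langle x_0', x\rangle = 1 \big\}$$ of $\mathcal{C}(X,Y)'$. Endow its weak-$*$ closure $\overline{S'}$ with the weak-$*$ topology and consider the composition $$\Phi : \mathcal{C}(X,Y) \to \mathcal{C}(X,Y)'' \to \mathrm{C}(\overline{S'})$$ of the canonical embedding and the restriction to $\overline{S'}$, i.e. $\Phi(T)(\varphi) = \langle \varphi, T\rangle$ for $T \in \mathcal{C}(X,Y)$ and $\varphi \in \overline{S'}$. Then the space $\mathrm{C}(\overline{S'})$ together with the map $\Phi$ is a vector lattice cover of $\mathcal{C}(X,Y)$.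
   Context: All vector spaces are real. A wedge in a real vector space $V$ is a non-empty subset $V_+$ with $\alpha V_+ + \beta V_+ \subseteq V_+$ for all real $\alpha,\beta \ge 0$; it is a cone if in addition $V_+ \cap (-V_+) = \{0\}$. One writes $x \le y$ if $y - x \in V_+$, and $[v_1,v_2] = \{x \in V : v_1 \le x \le v_2\}$. A vector $v \in V_+$ is called extremal in $V_+$ (an extremal vector of $V_+$) if all elements of $[0,v]$ are scalar multiples of $v$. An ordered normed space is a normed space $X$ (not necessarily complete) endowed with a norm closed cone $X_+$. The cone $X_+$ is total if its linear span is norm dense in $X$. A norm on $X$ is additive on $X_+$ if $\|x_1+x_2\| = \|x_1\|+\|x_2\|$ for all $x_1,x_2\in X_+$. The norm dual $X'$ is endowed with the dual wedge $X'_+ = \{x' \in X' : \langle x', x\rangle \ge 0 \text{ for all } x \in X_+\}$; the bidual $X''$ is endowed with $X''_+ = \{x'' \in X'' : \langle x'', x'\rangle \ge 0 \text{ for all } x' \in X'_+\}$. Interior points are meant with respect to the norm topologies. $\mathcal{L}(X,Y)$ is the space of bounded linear operators from $X$ to $Y$ with the operator norm, and $\mathcal{L}(X,Y)_+ = \{T \in \mathcal{L}(X,Y): T[X_+] \subseteq Y_+\}$. $\mathcal{C}(X,Y)$ is the operator norm closure in $\mathcal{L}(X,Y)$ of the subspace of bounded finite rank operators, ordered by $\mathcal{C}(X,Y)_+ = \mathcal{C}(X,Y) \cap \mathcal{L}(X,Y)_+$. For $x \in X$ and $y' \in Y'$, the functional $y' \otimes x \in \mathcal{C}(X,Y)'$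 is given by $\langle y' \otimes x, T\rangle = \langle y', Tx\rangle$. The weak-$*$ topology on $\mathcal{C}(X,Y)'$ is the topology of pointwise convergence on $\mathcal{C}(X,Y)$. For a topological space $K$, $\mathrm{C}(K)$ is the space of continuous real-valued functions on $K$ with the pointwise order. A linear map $\Phi : V \to W$ between ordered vector spaces is bipositive if for all $v\in V$: $v \ge 0 \iff \Phi(v) \ge 0$. A vector lattice $W$ together with a bipositive linear map $\Phi : V \to W$ is a vector lattice cover of the ordered vector space $V$ if each $w \in W$ is the infimum in $W$ of the set $\{u \in \Phi[V] : u \ge w\}$. *)

(* Defs.v *)
From HB Require Import structures.
From mathcomp Require Import all_boot all_order all_algebra.
From mathcomp Require Import all_classical all_reals all_analysis.

Set Implicit Arguments.
Unset Strict Implicit.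
Unset Printing Implicit Defensive.

Import Order.TTheory GRing.Theory Num.Theory.
Import numFieldNormedType.Exports.

Local Open Scope classical_set_scope.
Local Open Scope ring_scope.

Section OrderedVectorSpaces.
Context {R : realType}.
Implicit Types V W : lmodType R.

Definition wedge V (P : set V) :=
  P !=set0 /\ forall (a b : R) (x y : V),
    0 <= a -> 0 <= b -> P x -> P y -> P (a *: x + b *: y).

Definition cone V (P : set V) :=
  wedge P /\ P `&` [set - x | x in P] = [set 0].

Definition cle V (P : set V) (x y : V) := P (y - x).

Definition order_interval V (P : set V) (v1 v2 : V) :=
  [set x | cle P v1 x /\ cle P x v2].

(* The zero vector is extremal: no nontriviality is required. *)
Definition extremal V (P : set V) (v : V) :=
  P v /\ forall x, order_interval P 0 v x -> exists a : R, x = a *: v.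

Definition lin_span V (A : set V) : set V :=
  [set x | exists n (a : 'I_n -> R) (v : 'I_n -> V),
    (forall i, A (v i)) /\ x = \sum_(i < n) a i *: v i].

(* [\sum_(i < n) a i = 1] forces [0 < n]. *)
Definition conv_hull V (A : set V) : set V :=
  [set x | exists n (a : 'I_n -> R) (v : 'I_n -> V),
    [/\ forall i, 0 <= a i, \sum_(i < n) a i = 1,
        forall i, A (v i) & x = \sum_(i < n) a i *: v i]].

Definition is_inf V (P : set V) (A : set V) (m : V) :=
  (forall a, A a -> cle P m a) /\
  (forall l, (forall a, A a -> cle P l a) -> cle P l m).

Definition is_sup V (P : set V) (A : set V) (m : V) :=
  (forall a, A a -> cle P a m) /\
  (forall u, (forall a, A a -> cle P a u) -> cle P m u).

Definition vector_lattice V (P : set V) :=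
  cone P /\ forall x y, exists m, is_sup P [set x; y] m.

Definition bipositive V W (P : set V) (Q : set W) (Phi : V -> W) :=
  forall v, P v <-> Q (Phi v).

Definition vector_lattice_cover V W (P : set V) (Q : set W) (Phi : V -> W) :=
  [/\ cone P, vector_lattice Q, linear Phi, bipositive P Q Phi &
      forall w, is_inf Q [set u | range Phi u /\ cle Q w u] w].

End OrderedVectorSpaces.

Section NormedSpaces.
Context {R : realType}.
Implicit Types X Y : normedModType R.

Definition ordered_normed_space X (Xp : set X) := cone Xp /\ closed Xp.

Definition total_cone X (Xp : set X) := dense (lin_span Xp).

Definition is_norm X (N : X -> R) :=
  [/\ forall x, N x = 0 -> x = 0,
      forall (a : R) x, N (a *: x) = `|a| * N x &
      forall x y, N (x + y) <= N x + N y].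

Definition equivalent_norm X (N : X -> R) :=
  is_norm N /\ exists c C : R,
    [/\ 0 < c, 0 < C & forall x, c * `|x| <= N x <= C * `|x|].

Definition additive_on X (Xp : set X) (N : X -> R) :=
  forall x1 x2, Xp x1 -> Xp x2 -> N (x1 + x2) = N x1 + N x2.

End NormedSpaces.

Section BoundedOperators.
Context {R : realType} (X Y : normedModType R).

Definition bop_pred : {pred X -> Y} :=
  mem [set T : X -> Y |
    linear T /\ exists M : R, forall x, `|T x| <= M * `|x|].

(* [bop X Y] is the space of bounded linear operators; [bop X R^o] is the norm
   dual of [X]. *)
Record bop := Bop { bop_fun :> X -> Y ; _ : bop_fun \in bop_pred }.

HB.instance Definition _ := [isSub for bop_fun].
HB.instance Definition _ := [Choice of bop by <:].

Lemma bop_submod_closed : submod_closed bop_pred.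
Proof.
split.
  rewrite inE; split; first by move=> a x y /=; rewrite scaler0 addr0.
  by exists 0 => x; rewrite normr0 mul0r.
move=> a f g; rewrite !inE => -[fL [M fM]] [gL [N gN]]; split.
  move=> b x y; rewrite addrfctE scalrfctE fL gL.
  by rewrite !scalerDr !scalerA [a * b]mulrC addrACA.
exists (`|a| * M + N) => x; rewrite addrfctE scalrfctE.
rewrite (le_trans (ler_normD _ _))// mulrDl lerD// normrZ -mulrA.
by rewrite ler_wpM2l.
Qed.

HB.instance Definition _ :=
  GRing.isSubmodClosed.Build R (X -> Y) bop_pred bop_submod_closed.
HB.instance Definition _ := [SubChoice_isSubLmodule of bop by <:].

Lemma bop_linear (T : bop) : linear T.
Proof. by case: T => T /=; rewrite inE => -[]. Qed.

HB.instance Definition _ (T : bop) :=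
  GRing.isLinear.Build R X Y *:%R (bop_fun T) (bop_linear T).

Lemma bop_bounded (T : bop) : exists M : R, forall x, `|T x| <= M * `|x|.
Proof. by case: T => T /=; rewrite inE => -[]. Qed.

Lemma bopP (S T : bop) : S =1 T -> S = T.
Proof. by move=> ST; apply: val_inj; apply/funext. Qed.

Lemma bopDE (S T : bop) x : (S + T) x = S x + T x.
Proof. by []. Qed.

Lemma bopZE (a : R) (T : bop) x : (a *: T) x = a *: T x.
Proof. by []. Qed.

Definition bop_norm (T : bop) : R :=
  sup [set `|T x| | x in [set x : X | `|x| <= 1]].

Let bop_norm_has_sup (T : bop) :
  has_sup [set `|T x| | x in [set x : X | `|x| <= 1]].
Proof.
split; first by exists `|T 0|, 0 => //=; rewrite normr0.
have [M TM] := bop_bounded T; exists `|M| => _ [x /= x1 <-].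
rewrite (le_trans (TM x))// (@le_trans _ _ (`|M| * `|x|))//.
  by rewrite ler_wpM2r// ler_norm.
by rewrite ler_piMr.
Qed.

Lemma bop_norm_ub (T : bop) x : `|x| <= 1 -> `|T x| <= bop_norm T.
Proof.
move=> x1; apply: (ub_le_sup _ _); last by exists x.
by case: (bop_norm_has_sup T).
Qed.

Lemma bop_norm_lub (T : bop) (M : R) :
  (forall x, `|x| <= 1 -> `|T x| <= M) -> bop_norm T <= M.
Proof.
move=> TM; apply: ge_sup; first by case: (bop_norm_has_sup T).
by move=> _ [x /= x1 <-]; exact: TM.
Qed.

Lemma bop_norm_ge0 (T : bop) : 0 <= bop_norm T.
Proof. by rewrite -(normr0 Y) -(linear0 T) bop_norm_ub// normr0. Qed.

Lemma bop_norm_le (T : bop) x : `|T x| <= bop_norm T * `|x|.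
Proof.
have [->|x0] := eqVneq x 0; first by rewrite linear0 !normr0 mulr0.
have nx0 : 0 < `|x| by rewrite normr_gt0.
have : `|T (`|x|^-1 *: x)| <= bop_norm T.
  by apply: bop_norm_ub; rewrite normrZ normfV normr_id mulVf// gt_eqF.
by rewrite linearZ normrZ normfV normr_id mulrC ler_pdivrMr.
Qed.

Lemma bop_normD (S T : bop) : bop_norm (S + T) <= bop_norm S + bop_norm T.
Proof.
apply: bop_norm_lub => x x1; rewrite bopDE (le_trans (ler_normD _ _))//.
by rewrite lerD// bop_norm_ub.
Qed.

Lemma bop_normZ (a : R) (T : bop) : bop_norm (a *: T) = `|a| * bop_norm T.
Proof.
have le_normZ (b : R) (S : bop) : bop_norm (b *: S) <= `|b| * bop_norm S.
  apply: bop_norm_lub => x x1.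
  by rewrite bopZE normrZ ler_wpM2l// bop_norm_ub.
apply/eqP; rewrite eq_le le_normZ /=.
have [->|a0] := eqVneq a 0; first by rewrite normr0 mul0r bop_norm_ge0.
rewrite -ler_pdivlMl ?normr_gt0// -normfV.
by rewrite -[X in bop_norm X <= _](scalerK a0).
Qed.

Lemma bop_norm0_eq0 (T : bop) : bop_norm T = 0 -> T = 0.
Proof.
move=> T0; apply: bopP => x; apply/eqP.
by rewrite -normr_le0 (le_trans (bop_norm_le T x))// T0 mul0r.
Qed.

HB.instance Definition _ :=
  Lmodule_isNormed.Build R bop bop_normD bop_normZ bop_norm0_eq0.

Lemma bop_normE (T : bop) :
  `|T| = sup [set `|T x| | x in [set x : X | `|x| <= 1]].
Proof. by []. Qed.

Lemma le_normr_bop (T : bop) x : `|T x| <= `|T| * `|x|.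
Proof. exact: bop_norm_le. Qed.

Definition op_cone (Xp : set X) (Yp : set Y) : set bop :=
  [set T | T @` Xp `<=` Yp].

Definition finite_rank : set bop :=
  [set T | exists n (v : 'I_n -> Y), range T `<=` lin_span (range v)].

End BoundedOperators.

Arguments bop_pred {R} X Y.

Section Duals.
Context {R : realType}.

Definition dual_wedge (X : normedModType R) (Xp : set X) : set (bop X R^o) :=
  [set f | forall x, Xp x -> 0 <= (f x : R)].

Lemma bidual_emb_subproof (X : normedModType R) (x : X) :
  (fun f : bop X R^o => f x) \in bop_pred (bop X R^o) R^o.
Proof.
rewrite inE; split; first by [].
by exists `|x| => f; rewrite mulrC; exact: le_normr_bop.
Qed.

Definition bidual_emb (X : normedModType R) (x : X) : bop (bop X R^o) R^o :=
  Bop (bidual_emb_subproof x).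

(* [bop V R^o] also carries the norm topology, hence the separate name for the
   topology of pointwise convergence. *)
Definition weakstar (V : normedModType R) : Type :=
  initial_topology (fun f : bop V R^o => (f : V -> R^o) : {ptws V -> R^o}).

HB.instance Definition _ (V : normedModType R) :=
  Topological.on (weakstar V).

End Duals.

Section ApproximableOperators.
Context {R : realType} (X Y : normedModType R).

Let closure_bopP (A : set (bop X Y)) (T : bop X Y) :
  closure A T <-> forall e : R, 0 < e -> exists2 S, A S & `|T - S| < e.
Proof.
split=> [AT e e0|AT B /nbhs_normP[e /= e0 eB]].
  by have [S [AS TS]] := AT _ (nbhsx_ballx T e e0); exists S;
    rewrite // -ball_normE in TS.
by have [S AS TS] := AT _ e0; exists S; split => //; exact: eB.
Qed.

Let finite_rank0 : finite_rank (0 : bop X Y).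
Proof.
exists 0%N, (fun=> 0) => _ [x _ <-].
exists 0%N, (fun=> 0), (fun=> 0); split; first by case.
by rewrite big_ord0.
Qed.

Let finite_rankP (T : bop X Y) : finite_rank T <->
  exists n (v : 'I_n -> Y), forall x, exists a : 'I_n -> R,
    T x = \sum_(i < n) a i *: v i.
Proof.
split=> -[n [v Tv]]; exists n, v.
  move=> x; have [m [a [w [wv ->]]]] := Tv (T x) (imageT _ _).
  have {wv}/choice[j jw] : forall i, exists j, v j = w i.
    by move=> i; have [j _ <-] := wv i; exists j.
  exists (fun k => \sum_(i < m | j i == k) a i).
  rewrite (partition_big j predT)//=; apply: eq_bigr => k _.
  by rewrite scaler_suml; apply: eq_bigr => i /eqP <-; rewrite jw.
move=> _ [x _ <-]; have [a Tx] := Tv x; by exists n, a, v.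
Qed.

Let finite_rankZD (a : R) (S T : bop X Y) :
  finite_rank S -> finite_rank T -> finite_rank (a *: S + T).
Proof.
move=> /finite_rankP[n [v Sv]] /finite_rankP[m [w Tw]]; apply/finite_rankP.
exists (n + m)%N, (fun i => match fintype.split i with inl j => v j | inr k => w k end).
move=> x; have [b Sx] := Sv x; have [c Tx] := Tw x.
exists (fun i => match fintype.split i with inl j => a * b j | inr k => c k end).
rewrite bopDE bopZE Sx Tx scaler_sumr big_split_ord /=; congr +%R.
  by apply: eq_bigr => i _; rewrite (unsplitK (inl i)) scalerA.
by apply: eq_bigr => i _; rewrite (unsplitK (inr i)).
Qed.

(* [aop X Y] is the operator norm closure of the finite rank operators, a
   normed space for the operator norm. *)
Definition aop_pred : {pred bop X Y} := mem (closure (@finite_rank R X Y)).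

Lemma aop_submod_closed : submod_closed aop_pred.
Proof.
split.
  by rewrite inE; exact: subset_closure.
move=> a S T; rewrite !inE => /closure_bopP clS /closure_bopP clT.
apply/closure_bopP => e e0.
have d0 : 0 < e / 2 / (`|a| + 1).
  by rewrite !divr_gt0// ltr_wpDl.
have [S' S'f SS'] := clS _ d0.
have [|T' T'f TT'] := clT (e / 2); first by rewrite divr_gt0.
exists (a *: S' + T'); first exact: finite_rankZD.
rewrite opprD addrACA -scalerBr (le_lt_trans (ler_normD _ _))//.
rewrite [ltRHS]splitr ler_ltD// normrZ.
rewrite (@le_trans _ _ ((`|a| + 1) * `|S - S'|))//.
  by rewrite ler_wpM2r// lerDl.
by rewrite mulrC -ler_pdivlMr ?ltr_wpDl// ltW.
Qed.

HB.instance Definition _ :=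
  GRing.isSubmodClosed.Build R (bop X Y) aop_pred aop_submod_closed.

Record aop := Aop { aop_bop :> bop X Y ; _ : aop_bop \in aop_pred }.

HB.instance Definition _ := [isSub for aop_bop].
HB.instance Definition _ := [Choice of aop by <:].
HB.instance Definition _ := [SubChoice_isSubLmodule of aop by <:].

Definition aop_norm (T : aop) : R := `|aop_bop T|.

Let aop_normD (S T : aop) : aop_norm (S + T) <= aop_norm S + aop_norm T.
Proof. exact: ler_normD. Qed.

Let aop_normZ (a : R) (T : aop) : aop_norm (a *: T) = `|a| * aop_norm T.
Proof. exact: normrZ. Qed.

Let aop_norm0_eq0 (T : aop) : aop_norm T = 0 -> T = 0.
Proof. by move=> /normr0_eq0 T0; apply: val_inj. Qed.

HB.instance Definition _ :=
  Lmodule_isNormed.Build R aop aop_normD aop_normZ aop_norm0_eq0.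

Definition aop_cone (Xp : set X) (Yp : set Y) : set aop :=
  [set T | op_cone Xp Yp T].

Lemma tensor_subproof (y' : bop Y R^o) (x : X) :
  (fun T : aop => y' (T x)) \in bop_pred aop R^o.
Proof.
rewrite inE; split; first by move=> a S T; rewrite bopDE bopZE linearP.
exists (`|y'| * `|x|) => T; rewrite (le_trans (le_normr_bop y' _))//.
rewrite -mulrA ler_wpM2l// mulrC.
exact: (le_normr_bop (T : bop X Y) x).
Qed.

(* y' (x) x, acting on operators by T |-> y' (T x). *)
Definition tensor (y' : bop Y R^o) (x : X) : bop aop R^o :=
  Bop (tensor_subproof y' x).

End ApproximableOperators.

Section ContinuousFunctions.
Context {R : realType} (K : topologicalType).
Local Notation CK := (continuousType K R^o).
Implicit Types f g h : CK.

Let cts_add_subproof f g : continuous (fun k => f k + g k : R^o).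
Proof. by move=> k; apply: cvgD; exact: cts_fun. Qed.

Let cts_opp_subproof f : continuous (fun k => - f k : R^o).
Proof. by move=> k; apply: cvgN; exact: cts_fun. Qed.

Let cts_scale_subproof (a : R) f : continuous (fun k => a *: f k : R^o).
Proof. by move=> k; apply: cvgZl_tmp; exact: cts_fun. Qed.

Let cts_zero_subproof : continuous (fun _ : K => 0 : R^o).
Proof. by move=> k; exact: cvg_cst. Qed.

Definition cts_add f g : CK := mkcts (@cts_add_subproof f g).
Definition cts_opp f : CK := mkcts (@cts_opp_subproof f).
Definition cts_scale (a : R) f : CK := mkcts (@cts_scale_subproof a f).
Definition cts_zero : CK := mkcts cts_zero_subproof.

Let cts_addA : associative cts_add.
Proof. by move=> f g h; apply/continuousEP => k; exact: addrA. Qed.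

Let cts_addC : commutative cts_add.
Proof. by move=> f g; apply/continuousEP => k; exact: addrC. Qed.

Let cts_add0 : left_id cts_zero cts_add.
Proof. by move=> f; apply/continuousEP => k; exact: add0r. Qed.

Let cts_addN : left_inverse cts_zero cts_opp cts_add.
Proof. by move=> f; apply/continuousEP => k; exact: addNr. Qed.

HB.instance Definition _ :=
  GRing.isZmodule.Build CK cts_addA cts_addC cts_add0 cts_addN.

Let cts_scaleA (a b : R) f :
  cts_scale a (cts_scale b f) = cts_scale (a * b) f.
Proof. by apply/continuousEP => k; exact: scalerA. Qed.

Let cts_scale1 : left_id 1 cts_scale.
Proof. by move=> f; apply/continuousEP => k; exact: scale1r. Qed.

Let cts_scaleDr : right_distributive cts_scale +%R.
Proof. by move=> a f g; apply/continuousEP => k; exact: scalerDr. Qed.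

Let cts_scaleDl f : {morph cts_scale^~ f : a b / a + b}.
Proof. by move=> a b; apply/continuousEP => k; exact: scalerDl. Qed.

HB.instance Definition _ := GRing.Zmodule_isLmodule.Build R CK
  cts_scaleA cts_scale1 cts_scaleDr cts_scaleDl.

Definition cts_cone : set CK := [set f | forall k, 0 <= (f k : R)].

End ContinuousFunctions.

Section Evaluation.
Context {R : realType} (X Y : normedModType R).

Definition Sprime (Xp : set X) (Yp : set Y) (y0 : Y) (x0' : bop X R^o) :
    set (weakstar (aop X Y)) :=
  [set phi | exists (y' : bop Y R^o) (x : X),
    [/\ extremal Xp x, extremal (dual_wedge Yp) y',
        (y' y0 : R) * (x0' x : R) = 1 & phi = tensor y' x]].

Lemma restr_bidual_emb_continuous (A : set (weakstar (aop X Y))) (T : aop X Y) :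
  continuous (fun phi : A => bidual_emb T (\val phi)).
Proof.
pose val_ptws (f : weakstar (aop X Y)) : {ptws aop X Y -> R^o} := bop_fun f.
have valC : continuous (\val : A -> weakstar (aop X Y)).
  exact: initial_continuous.
have ptwsC : continuous val_ptws by exact: initial_continuous.
move=> phi; apply: (@continuous_comp _ _ _ (\val : A -> weakstar (aop X Y))).
  exact: valC.
apply: (@continuous_comp _ _ _ val_ptws (proj T)); first exact: ptwsC.
exact: (@proj_continuous (aop X Y) (fun=> R^o) T).
Qed.

(* The restriction to [A] of the canonical image of [T] in the bidual. *)
Definition eval_on (A : set (weakstar (aop X Y))) (T : aop X Y) :
    continuousType A R^o :=
  mkcts (@restr_bidual_emb_continuous A T).

End Evaluation.

(* Main.v *)
From HB Require Import structures.
Require Import Defs.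
From mathcomp Require Import all_boot all_order all_algebra.
From mathcomp Require Import all_classical all_reals all_analysis.
From mathcomp Require Import lra ring.

Import Order.TTheory GRing.Theory Num.Theory.
Import numFieldNormedType.Exports.

Local Open Scope classical_set_scope.
Local Open Scope ring_scope.

(** Write [V] for the approximable operators [aop X Y], [P] for its positive
    cone and [u] for the rank one operator [x0' (x) y0]. The functional [x0']
    controls the norm on the cone of [X] (norm_le_interior), so [u] is an
    order unit of [V] (rank1_order_unit), and the elements of [S'] are states:
    positive functionals equal to 1 at [u]. Three facts about [S'] suffice.

    - [S'] determines [P] (Sprime_separates). If [T x] is not positive for some
      extremal [x], then some extremal functional on [Y] is negative at [T x],
      because the base [{y' >= 0 | y' y0 = 1}] has enough extreme points
      (extremal_separation). The assumption on convex combinations of extremal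
      vectors then carries positivity of [T] to the whole cone of [X].

    - Every [y' (x) x] in [S'] is an extremal positive functional on [V]
      (extremal_tensor). If [0 <= psi <= y' (x) x], then for [f >= 0] in the
      dual of [X] the functional [y |-> psi (f (x) y)] lies below [f x] times
      [y'], hence equals [a f] times [y']; the map [a] is an element of the
      bidual lying below [x], hence a multiple of [x]. So [psi] is a multiple of
      [y' (x) x] on rank one operators, which determine it
      (functional_rank1_eq0).

    - The weak-* closure [K] of [S'] is compact (weakstar_compact).

    The cover property then holds for abstract reasons
    (closure_extremal_states_cover). Let [k0] be a point of [K] coming from [S']
    and [w] continuous on [K]. The upper envelope [env w], the infimum of
    [T k0] over the operators [T] with [w <= T] on [K], is sublinear in [w], so
    Hahn-Banach gives a linear [mu <= env] with [mu w = env w]; this [mu] is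
    positive and extends evaluation at [k0] from [V] to the continuous functions
    on [K]. For an operator [U] between 0 and [u], the functional
    [T |-> mu (U T)] is positive and below [k0], so extremality makes it a
    multiple of [k0]: [mu (U T) = k0 U * k0 T] (mu_mul). In particular [mu]
    vanishes on the squares [(T - k0 T)^2], which forces [mu] to be evaluation
    at [k0]. Therefore [env w = w k0] on [S'], which is dense in [K].

    Hahn-Banach and Krein-Milman are both taken from extreme_dominated, which
    produces extreme linear functionals below a sublinear one. *)

(** * Extreme linear functionals below a sublinear one *)

Section Sublinear.
Context {R : realType} {V : lmodType R}.
Implicit Types p q f g h : V -> R.

Definition sublinear p :=
  (forall x y, p (x + y) <= p x + p y) /\
  (forall (a : R) x, 0 <= a -> p (a *: x) <= a * p x).

Lemma sublinear0 p : sublinear p -> p 0 = 0.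
Proof.
move=> [pD pZ]; have := pD 0 0; have := pZ 0 0 (lexx 0).
rewrite scale0r addr0; lra.
Qed.

Lemma sublinearN p x : sublinear p -> - p (- x) <= p x.
Proof.
move=> ps; have [pD _] := ps; have := pD x (- x).
by rewrite subrr sublinear0//; lra.
Qed.

Lemma sublinearZ p (a : R) x : sublinear p -> 0 <= a -> p (a *: x) = a * p x.
Proof.
move=> ps; have [_ pZ] := ps; rewrite le_eqVlt => /predU1P[<-|a0].
  by rewrite scale0r mul0r sublinear0.
apply/eqP; rewrite eq_le pZ ?(ltW a0)//= -ler_pdivlMl//.
have := pZ a^-1 (a *: x); rewrite scalerA mulVf ?gt_eqF// scale1r.
by apply; rewrite invr_ge0 ltW.
Qed.

Lemma sublinear_linear p : sublinear p -> (forall x, p (- x) <= - p x) ->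
  linear (p : V -> R^o).
Proof.
move=> ps pN; have [pD _] := ps.
have pNE x : p (- x) = - p x.
  by have := pN x; have := sublinearN p x ps; lra.
move=> a x y; have -> : p (a *: x + y) = p (a *: x) + p y.
  have := pD (a *: x) y; have := pD (- (a *: x)) (- y).
  by rewrite -opprD !pNE; lra.
congr (_ + _); have [a0|/ltW a0] := leP 0 a; first exact: sublinearZ.
rewrite -[a *: x]opprK -scaleNr pNE sublinearZ ?oppr_ge0//.
by rewrite mulNr opprK.
Qed.

Lemma linear_funN f x : linear (f : V -> R^o) -> f (- x) = - f x.
Proof.
move=> fL; pose F : {linear V -> R^o} :=
  HB.pack (f : V -> R^o) (GRing.isLinear.Build R V R^o *:%R f fL).
exact: (linearN F).
Qed.

(** Among the linear functionals [f] below [q], those with [f z] equal to [q z]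
    form a face; this is its support function. *)
Definition tilt q z : V -> R :=
  fun y => inf [set q (y + t *: z) - t * q z | t in [set t : R | 0 <= t]].

Lemma tilt_le q z y (t : R) : sublinear q -> 0 <= t ->
  tilt q z y <= q (y + t *: z) - t * q z.
Proof.
move=> qs t0; apply: ge_inf; last by exists t.
exists (- q (- y)) => _ [s /= s0 <-]; have [qD _] := qs.
have := qD (y + s *: z) (- y).
by rewrite addrAC subrr add0r sublinearZ//; lra.
Qed.

Lemma le_tilt q z y (b : R) :
  (forall t : R, 0 <= t -> b <= q (y + t *: z) - t * q z) -> b <= tilt q z y.
Proof.
move=> H; apply: lb_le_inf; first by exists (q (y + 0 *: z) - 0 * q z), 0 => /=.
by move=> _ [t /= t0 <-]; exact: H.
Qed.

Lemma tilt_le_self q z y : sublinear q -> tilt q z y <= q y.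
Proof.
move=> qs; have := tilt_le q z y 0 qs (lexx 0).
by rewrite scale0r addr0 mul0r subr0.
Qed.

Lemma tiltN q z : sublinear q -> tilt q z (- z) <= - q z.
Proof.
move=> qs; have := tilt_le q z (- z) 1 qs ler01.
by rewrite scale1r addNr sublinear0// mul1r add0r.
Qed.

Lemma tilt_sublinear q z : sublinear q -> sublinear (tilt q z).
Proof.
move=> qs; have [qD _] := qs; split=> [x y|a x].
  rewrite -lerBlDr; apply: le_tilt => t t0.
  rewrite lerBlDr -lerBlDl; apply: le_tilt => s s0.
  have := tilt_le q z (x + y) (t + s) qs (addr_ge0 t0 s0).
  by have := qD (x + t *: z) (y + s *: z); rewrite addrACA -scalerDl; lra.
rewrite le_eqVlt => /predU1P[<-|a0].
  rewrite scale0r mul0r (le_trans (tilt_le_self q z 0 qs))//.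
  by rewrite sublinear0.
rewrite -ler_pdivrMl//; apply: le_tilt => t t0; rewrite ler_pdivrMl//.
have := tilt_le q z (a *: x) (a * t) qs (mulr_ge0 (ltW a0) t0).
by rewrite -scalerA -scalerDr (sublinearZ q) ?(ltW a0)// -mulrA -mulrBr.
Qed.

Definition dominated p f := linear (f : V -> R^o) /\ forall x, f x <= p x.

(** Faces of the convex set of linear functionals below [p], encoded by their
    support functions. With a face replaced by a sublinear functional, shrinking
    faces becomes lowering functionals, and the intersection of a chain is a
    pointwise infimum. *)
Definition facial p q := [/\ sublinear q, forall x, q x <= p x &
  forall g h, dominated p g -> dominated p h ->
    (forall x, g x + h x <= q x *+ 2) -> forall x, g x <= q x].

Lemma facial_tilt p q z : facial p q -> facial p (tilt q z).
Proof.
move=> [qs qp qF]; split; first exact: tilt_sublinear.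
  by move=> x; exact: le_trans (tilt_le_self q z x qs) (qp x).
move=> g h gp hp ghq.
have ghq' x : g x + h x <= q x *+ 2.
  by rewrite (le_trans (ghq x))// lerMn2r tilt_le_self.
have gq := qF g h gp hp ghq'.
have hq : forall x, h x <= q x.
  by apply: (qF h g) => // x; rewrite addrC; exact: ghq'.
have [gL _] := gp; have [hL _] := hp.
(* [g + h] attains the maximum at [z] and [g], [h] cannot exceed it, so each of
   them attains it *)
have gz : g z = q z.
  have := ghq (- z); have := tiltN q z qs.
  rewrite (linear_funN g)// (linear_funN h)//.
  by have := gq z; have := hq z; lra.
move=> x; apply: le_tilt => t t0; have := gq (x + t *: z).
by rewrite addrC gL gz /GRing.scale/=; lra.
Qed.

Lemma facial_inf p (C : set (V -> R)) : C !=set0 -> C `<=` facial p ->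
  (forall q r, C q -> C r ->
    (forall x, q x <= r x) \/ (forall x, r x <= q x)) ->
  facial p (fun x => inf [set q x | q in C]) /\
  forall q, C q -> forall x, inf [set q x | q in C] <= q x.
Proof.
move=> [q0 Cq0] CF Ctot.
have infle q x : C q -> inf [set q x | q in C] <= q x.
  move=> Cq; apply: ge_inf; last by exists q.
  exists (- p (- x)) => _ [r Cr <-]; have [rs rp _] := CF _ Cr.
  by have := rp (- x); have := sublinearN r x rs; lra.
have leinf x b : (forall q, C q -> b <= q x) -> b <= inf [set q x | q in C].
  move=> H; apply: lb_le_inf; first by exists (q0 x), q0.
  by move=> _ [q Cq <-]; exact: H.
split; last by move=> q Cq x; exact: infle.
split.
- split=> [x y|a x a0].
    rewrite -lerBlDr; apply: (leinf _ _) => q Cq.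
    rewrite lerBlDr -lerBlDl; apply: (leinf _ _) => r Cr.
    have [[qD _] _ _] := CF _ Cq; have [[rD _] _ _] := CF _ Cr.
    have [qr|rq] := Ctot _ _ Cq Cr.
      by have := infle q (x + y) Cq; have := qD x y; have := qr y; lra.
    by have := infle r (x + y) Cr; have := rD x y; have := rq x; lra.
  move: a0; rewrite le_eqVlt => /predU1P[<-|a0].
    have [qs _ _] := CF _ Cq0.
    by have := infle q0 0 Cq0; rewrite scale0r mul0r sublinear0.
  rewrite -ler_pdivrMl//; apply: (leinf _ _) => q Cq; rewrite ler_pdivrMl//.
  have [qs _ _] := CF _ Cq; rewrite -sublinearZ ?(ltW a0)//; exact: infle.
- move=> x; have [_ q0p _] := CF _ Cq0.
  exact: le_trans (infle _ _ Cq0) (q0p x).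
- move=> g h gp hp ghq x; apply: (leinf _ _) => q Cq; have [_ _ qF] := CF _ Cq.
  apply: (qF g h) => // y; rewrite (le_trans (ghq y))// lerMn2r; exact: infle.
Qed.

(** Hahn-Banach and Krein-Milman at once. By Zorn there is a minimal facial [q]
    below [tilt p v]; minimality under tilting in every direction [z] gives
    [q (- z) <= - q z], so [q] is linear, and a face with a single element is an
    extreme point. Starting from [tilt p v] enforces the value at [v]. *)
Lemma extreme_dominated p v : sublinear p ->
  exists f, [/\ dominated p f, f v = p v &
    forall g h, dominated p g -> dominated p h ->
      (forall x, g x + h x = f x *+ 2) -> g = f].
Proof.
move=> ps.
pose F := {q : V -> R | facial p q /\ q (- v) <= - p v}.
have t0 : F.
  exists (tilt p v); split; last exact: tiltN.
  by apply: facial_tilt; split=> // g h [].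
pose le (q r : F) := `[< forall x, sval r x <= sval q x >].
have [||A Atot|q qmin] := @ZL_preorder F t0 le.
- by move=> q; apply/asboolP => x.
- move=> q r s /asboolP qr /asboolP rs; apply/asboolP => x.
  exact: le_trans (qr x).
- have [A0|/set0P[a Aa]] := eqVneq A set0.
    by exists t0 => s; rewrite A0.
  have [|_ [s _ <-]|q r [s As <-] [t At <-]|infF infle] :=
      @facial_inf p [set sval s | s in A].
  + by exists (sval a), a.
  + by have [] := svalP s.
  + by case: (Atot s t As At) => /asboolP st; [right|left].
  have infv : inf [set q (- v) | q in [set sval s | s in A]] <= - p v.
    have [_ av] := svalP a.
    by apply: le_trans (infle (sval a) _ (- v)) av; exists a.
  pose m : F :=
    exist (fun q => facial p q /\ q (- v) <= - p v) _ (conj infF infv).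
  exists m => s As; apply/asboolP => x /=.
  by apply: infle; exists s.
have [qF qv] := svalP q; have [qs qp qext] := qF.
have qlin : linear (sval q : V -> R^o).
  apply: sublinear_linear => // z.
  have tv : tilt (sval q) z (- v) <= - p v.
    exact: le_trans (tilt_le_self _ z _ qs) qv.
  pose r : F :=
    exist (fun q => facial p q /\ q (- v) <= - p v) _
      (conj (facial_tilt p (sval q) z qF) tv).
  have /qmin/asboolP/(_ (- z))/le_trans : le q r.
    by apply/asboolP => x; exact: tilt_le_self.
  by apply; exact: tiltN.
exists (sval q); split; first by split.
- apply/eqP; rewrite eq_le qp/=.
  by have := sublinearN (sval q) v qs; lra.
- move=> g h gp hp ghE; apply/funext => x; apply/eqP; rewrite eq_le.
  have ghle y : g y + h y <= sval q y *+ 2 by rewrite ghE.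
  have hgle y : h y + g y <= sval q y *+ 2 by rewrite addrC.
  rewrite (qext g h)//=; have := qext h g hp gp hgle x.
  by have := ghE x; lra.
Qed.
End Sublinear.

(** * Wedges, order units and separation by extremal functionals *)

Section Wedges.
Context {R : realType} {V : lmodType R} {P : set V}.
Hypothesis Pw : wedge P.

Lemma wedgeD x y : P x -> P y -> P (x + y).
Proof.
move=> Px Py; have [_ /(_ 1 1 x y ler01 ler01 Px Py)] := Pw.
by rewrite !scale1r.
Qed.

Lemma wedgeZ (a : R) x : 0 <= a -> P x -> P (a *: x).
Proof.
move=> a0 Px; have [_ /(_ a 0 x x a0 (lexx 0) Px Px)] := Pw.
by rewrite scale0r addr0.
Qed.

Lemma wedge0 : P 0.
Proof. by have [[x Px] _] := Pw; rewrite -(scale0r x); exact: wedgeZ. Qed.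

Lemma wedgeZ_gt0 (a : R) x : 0 < a -> P (a *: x) -> P x.
Proof.
move=> a0 /(wedgeZ a^-1); rewrite scalerA mulVf ?gt_eqF// scale1r.
by apply; rewrite invr_ge0 ltW.
Qed.

(** The scalar is allowed to vanish although a wedge may contain a line: passing
    from [a] to [a + 1] makes it invertible. *)
Lemma extremal_le (a : R) x y : extremal P x -> 0 <= a -> P y ->
  P (a *: x - y) -> exists c : R, y = c *: x.
Proof.
move=> [Px xE] a0 Py Pxy; have b0 : 0 < a + 1 by rewrite ltr_wpDl.
have [|c yE] := xE ((a + 1)^-1 *: y).
  split; rewrite /cle ?subr0.
    by apply: wedgeZ => //; rewrite invr_ge0 ltW.
  apply: (@wedgeZ_gt0 (a + 1)) => //.
  rewrite scalerBr scalerA mulfV ?gt_eqF// scale1r scalerDl scale1r addrAC.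
  exact: wedgeD.
exists ((a + 1) * c); rewrite -scalerA -yE scalerA mulfV ?gt_eqF//.
by rewrite scale1r.
Qed.

Lemma extremalZ (a : R) x : 0 < a -> extremal P x -> extremal P (a *: x).
Proof.
move=> a0 xE; split=> [|y]; first by apply: wedgeZ; [exact: ltW|case: xE].
rewrite /order_interval/= /cle subr0 => -[Py Pxy].
have [c ->] := extremal_le a x y xE (ltW a0) Py Pxy.
by exists (c / a); rewrite scalerA divfK// gt_eqF.
Qed.

Lemma wedge_sum n (a : 'I_n -> R) (v : 'I_n -> V) : (forall i, 0 <= a i) ->
  (forall i, P (v i)) -> P (\sum_(i < n) a i *: v i).
Proof.
move=> a0 Pv; elim/big_ind : _ => [||i _]; [exact: wedge0|exact: wedgeD|].
exact: wedgeZ.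
Qed.
End Wedges.

Section Gauge.
Context {R : realType} {V : lmodType R} {P : set V} {u : V}.
Hypothesis Pw : wedge P.
Hypothesis PNu : ~ P (- u).
Hypothesis Pu : forall x, exists M : R, P (M *: u - x).

Definition gauge x : R := inf [set t : R | P (t *: u - x)].

Lemma order_unit_ge0 (t : R) : P (t *: u) -> 0 <= t.
Proof.
move=> Ptu; rewrite leNgt; apply/negP => t0; apply: PNu.
by apply: (wedgeZ_gt0 Pw (- t)); rewrite ?oppr_gt0// scaleNr scalerN opprK.
Qed.

Lemma gauge_le x (t : R) : P (t *: u - x) -> gauge x <= t.
Proof.
move=> Pt; apply: ge_inf => //; have [M PM] := Pu (- x).
exists (- M) => s /= Ps; have := wedgeD Pw _ _ Ps PM.
by rewrite opprK addrCA subrK addrC -scalerDl => /order_unit_ge0; lra.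
Qed.

Lemma le_gauge x (b : R) : (forall t, P (t *: u - x) -> b <= t) -> b <= gauge x.
Proof. by move=> H; apply: lb_le_inf => //; exact: Pu. Qed.

Lemma gauge_sublinear : sublinear gauge.
Proof.
split=> [x y|a x].
  rewrite -lerBlDr; apply: le_gauge => t Pt.
  rewrite lerBlDr -lerBlDl; apply: le_gauge => s Ps.
  rewrite lerBlDl; apply: gauge_le.
  by rewrite scalerDl opprD addrACA; exact: wedgeD.
rewrite le_eqVlt => /predU1P[<-|a0].
  by rewrite mul0r; apply: gauge_le; rewrite !scale0r subr0; exact: wedge0.
rewrite -ler_pdivrMl//; apply: le_gauge => t Pt; rewrite ler_pdivrMl//.
apply: gauge_le; rewrite -scalerA -scalerBr.
by apply: wedgeZ => //; exact: ltW.
Qed.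

(** The states of an order unit space are the linear functionals below its
    gauge, which is what makes extreme_dominated applicable to them. *)
Lemma dominated_gauge (f : V -> R) : linear (f : V -> R^o) ->
  dominated gauge f <-> (forall x, P x -> 0 <= f x) /\ f u = 1.
Proof.
move=> fL; split=> [[_ fp]|[f0 fu]].
  split=> [x Px|].
    have /(le_trans (fp (- x))) : gauge (- x) <= 0.
      by apply: gauge_le; rewrite scale0r sub0r opprK.
    by rewrite linear_funN// oppr_le0.
  apply/eqP; rewrite eq_le; apply/andP; split.
    apply: le_trans (fp u) _; apply: gauge_le.
    by rewrite scale1r subrr; exact: wedge0.
  have /(le_trans (fp (- u))) : gauge (- u) <= -1.
    by apply: gauge_le; rewrite scaleN1r subrr; exact: wedge0.
  by rewrite linear_funN// lerN2.
split=> // x; apply: le_gauge => t /f0.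
by rewrite fL linear_funN// fu /GRing.scale/= mulr1 subr_ge0.
Qed.
End Gauge.
Arguments gauge {R V} P u x.

Section OrderUnits.
Context {R : realType}.

Lemma interior_order_unit (V : normedModType R) (P : set V) (u : V) :
  wedge P -> P° u -> exists2 M : R, 0 < M & forall v, P ((M * `|v|) *: u - v).
Proof.
move=> Pw /nbhs_normP[e /= e0 eP]; exists (2 / e) => [|v].
  by rewrite divr_gt0.
have [->|v0] := eqVneq v 0.
  by rewrite normr0 mulr0 scale0r subr0; exact: wedge0.
have t0 : 0 < 2 / e * `|v| by rewrite !mulr_gt0 ?invr_gt0 ?normr_gt0.
apply: (wedgeZ_gt0 Pw (2 / e * `|v|)^-1); first by rewrite invr_gt0.
rewrite scalerBr scalerA mulVf ?gt_eqF// scale1r; apply: eP => /=.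
rewrite opprB addrC subrK normrZ gtr0_norm ?invr_gt0//.
rewrite invfM -mulrA mulVf ?normr_eq0// mulr1 invf_div; lra.
Qed.

Lemma closed_archimedean (V : normedModType R) (P : set V) (u v : V) :
  closed P -> (forall e : R, 0 < e -> P (e *: u + v)) -> P v.
Proof.
move=> Pc H; apply: Pc => B /nbhs_normP[e /= e0 eB].
have d0 : 0 < e / (`|u| + 1) by rewrite divr_gt0// ltr_wpDl.
exists ((e / (`|u| + 1)) *: u + v); split; first exact: H.
apply: eB => /=; rewrite opprD addrCA subrr addr0 normrN normrZ gtr0_norm//.
rewrite -mulrA mulrC -ltr_pdivlMr// mulfV ?gt_eqF//.
by rewrite mulrC ltr_pdivrMr ?ltr_wpDl// mul1r ltrDl.
Qed.

Lemma bounded_bop (X : normedModType R) (f : X -> R) (C : R) :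
  linear (f : X -> R^o) -> (forall x, f x <= C * `|x|) ->
  exists F : bop X R^o, forall x, F x = f x.
Proof.
move=> fL fC; have fB : (f : X -> R^o) \in bop_pred X R^o.
  rewrite inE; split=> //; exists C => x; rewrite ler_norml fC andbT.
  by rewrite lerNl -linear_funN// -(normrN x).
by exists (Bop fB).
Qed.

Lemma norming_functional (X : normedModType R) (x : X) :
  exists f : bop X R^o, f x = `|x| :> R /\ `|f| <= 1.
Proof.
have ns : sublinear (fun z : X => `|z|).
  by split=> [y z|a z a0]; [exact: ler_normD|rewrite normrZ ger0_norm].
have [f [[fL fle] fx _]] := extreme_dominated _ x ns.
have [|F FE] := @bounded_bop X f 1 fL; first by move=> z; rewrite mul1r.
exists F; rewrite FE; split=> //; apply: bop_norm_lub => z z1.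
rewrite (le_trans _ z1)// FE; apply/ler_normlP; split=> //.
by rewrite -linear_funN// -[leRHS]normrN; exact: fle.
Qed.

(** An extreme point of the base [{f >= 0 | f y0 = 1}] of the dual wedge is
    extremal: for [0 <= g <= f] and [c = g y0], the functionals [f + (g - c f)]
    and [f - (g - c f)] both lie in the base and have midpoint [f]. *)
Lemma extremal_separation (Y : normedModType R) (Yp : set Y) (y0 y : Y) :
  wedge Yp -> closed Yp -> Yp° y0 -> ~ Yp y ->
  exists f : bop Y R^o,
    [/\ extremal (dual_wedge Yp) f, f y0 = 1 & f y < 0 :> R].
Proof.
move=> Yw Yc Yi NYy; have [M M0 YM] := interior_order_unit Y Yp y0 Yw Yi.
have Yy0 : Yp y0 by exact: interior_subset.
have YNy0 : ~ Yp (- y0).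
  move=> YN; apply: NYy; have := YM (- y); rewrite opprK => YMy.
  have := wedgeD Yw _ _ YMy (wedgeZ Yw (M * `|- y|) _ _ YN).
  by rewrite scalerN addrAC subrr add0r; apply; rewrite mulr_ge0// ltW.
have Yu x : exists N : R, Yp (N *: y0 - x) by exists (M * `|x|).
have gs := gauge_sublinear Yw YNy0 Yu.
have [f [fdom fy fext]] := extreme_dominated _ (- y) gs.
have [fL fle] := fdom.
have [f0 f1] := (dominated_gauge Yw YNy0 Yu f fL).1 fdom.
have [|F FE] := @bounded_bop Y f M fL.
  move=> x; apply: le_trans (fle x) _.
  exact: gauge_le Yw YNy0 Yu _ _ _.
exists F; split; last 1 first.
- rewrite FE -oppr_gt0 -linear_funN// fy ltNge; apply/negP => g0.
  apply: NYy; apply: (closed_archimedean Y Yp y0) => // e e0.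
  have [//|NP] := pselect (Yp (e *: y0 + y)).
  suff : e <= gauge Yp y0 (- y) by rewrite leNgt (le_lt_trans g0).
  apply: le_gauge => // t; rewrite opprK leNgt => Yt; apply/negP => te.
  apply: NP; rewrite -[e](subrK t) scalerDl -addrA; apply: wedgeD => //.
  by apply: wedgeZ => //; rewrite subr_ge0 ltW.
- split=> [x Yx|G [G0 GF]]; first by rewrite FE; exact: f0.
  move: G0; rewrite /cle subr0 => G0.
  have fG x : Yp x -> (G x : R) <= f x.
    by move=> Yx; rewrite -subr_ge0 -FE; exact: GF.
  pose c : R := G y0; have c0 : 0 <= c := G0 y0 Yy0.
  have c1 : c <= 1 by rewrite -f1; exact: (fG y0 Yy0).
  pose k (s : R) x : R := s * G x + (1 - s * c) * f x.
  have kdom s : (forall x, Yp x -> 0 <= k s x) -> dominated (gauge Yp y0) (k s).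
    move=> k0; apply/dominated_gauge => //; last first.
      by split=> //; rewrite /k f1 -/c; lra.
    move=> a v w; suff : k s (a *: v + w) = a * k s v + k s w by [].
    have GE : G (a *: v + w) = a * G v + G w :> R := linearP G a v w.
    have fE : f (a *: v + w) = a * f v + f w := fL a v w.
    by rewrite /k GE fE; ring.
  have k1 : dominated (gauge Yp y0) (k 1).
    apply: kdom => x Yx; rewrite /k !mul1r addr_ge0//; first exact: G0.
    by rewrite mulr_ge0 ?subr_ge0//; exact: f0.
  have kN1 : dominated (gauge Yp y0) (k (-1)).
    apply: kdom => x Yx; rewrite /k !mulN1r opprK mulrDl mul1r addrA.
    by rewrite addr_ge0 ?mulr_ge0 ?f0// addrC subr_ge0 fG.
  exists c; apply: bopP => x; rewrite bopZE FE.
  have kE z : k 1 z + k (-1) z = f z *+ 2 by rewrite /k; ring.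
  have /(congr1 (fun h => h x)) := fext _ _ k1 kN1 kE.
  by rewrite /k /GRing.scale/=; lra.
- by rewrite FE.
Qed.
End OrderUnits.

(** * Rank one operators and extremal functionals on operators *)

Lemma dual_le_norm {R : realType} {X : normedModType R} (f : bop X R^o) x :
  f x <= `|f| * `|x| :> R.
Proof. exact: le_trans (ler_norm _) (le_normr_bop f x). Qed.

Lemma dualZE {R : realType} {X : normedModType R} (f : bop X R^o) (a : R) x :
  f (a *: x) = a * (f x : R) :> R.
Proof. exact: linearZ. Qed.

Section RankOne.
Context {R : realType} {X Y : normedModType R}.

Lemma rank1_subproof (f : bop X R^o) (y : Y) :
  (fun x => (f x : R) *: y) \in bop_pred X Y.
Proof.
rewrite inE; split=> [a x z|]; first by rewrite linearP scalerDl scalerA.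
exists (`|f| * `|y|) => x; rewrite normrZ mulrAC ler_wpM2r//.
exact: le_normr_bop.
Qed.

Lemma finite_rank_rank1 f y : finite_rank (Bop (rank1_subproof f y)).
Proof.
exists 1%N, (fun=> y) => _ [x _ <-]; exists 1%N, (fun=> f x), (fun=> y).
by split=> [i|]; [exists i|rewrite big_ord1].
Qed.

Lemma finite_rank_aop (T : bop X Y) : finite_rank T -> T \in @aop_pred R X Y.
Proof. by move=> Tf; rewrite inE; exact: subset_closure. Qed.

Definition rank1 f y : aop X Y :=
  Aop (finite_rank_aop _ (finite_rank_rank1 f y)).

Lemma rank1E f y x : rank1 f y x = (f x : R) *: y.
Proof. by []. Qed.

Lemma aopP (S T : aop X Y) : (forall x, S x = T x) -> S = T.
Proof. by move=> ST; apply: val_inj; apply: bopP. Qed.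

Lemma aopDE (S T : aop X Y) x : (S + T) x = S x + T x.
Proof. by []. Qed.

Lemma aopZE (a : R) (T : aop X Y) x : (a *: T) x = a *: T x.
Proof. by []. Qed.

Lemma aopNE (T : aop X Y) x : (- T) x = - T x.
Proof. by []. Qed.

Lemma rank1_linearl y : linear (rank1^~ y).
Proof.
move=> a f g; apply: aopP => x; rewrite aopDE aopZE !rank1E bopDE bopZE.
by rewrite scalerDl scalerA.
Qed.

Lemma rank1_linearr f : linear (rank1 f).
Proof.
move=> a y z; apply: aopP => x; rewrite aopDE aopZE !rank1E.
by rewrite scalerDr !scalerA mulrC.
Qed.

Lemma norm_rank1 f y : `|rank1 f y| <= `|f| * `|y|.
Proof.
apply: bop_norm_lub => x x1; rewrite rank1E normrZ ler_wpM2r//.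
exact: bop_norm_ub.
Qed.

Lemma lin_span_range n (v : 'I_n -> Y) z : lin_span (range v) z ->
  exists a : 'I_n -> R, z = \sum_(i < n) a i *: v i.
Proof.
move=> [m [b [w [wv ->]]]].
have /choice[j jw] : forall i, exists j, v j = w i.
  by move=> i; have [j _ <-] := wv i; exists j.
exists (fun k => \sum_(i < m | j i == k) b i).
rewrite (partition_big j predT)//=; apply: eq_bigr => k _.
by rewrite scaler_suml; apply: eq_bigr => i /eqP <-; rewrite jw.
Qed.

Lemma coordinate_functional (v : Y) : exists g : bop Y R^o, (g v : R) *: v = v.
Proof.
have [->|v0] := eqVneq v 0; first by exists 0; rewrite scaler0.
have [g [gv _]] := norming_functional Y v.
exists (`|v|^-1 *: g); rewrite bopZE gv /GRing.scale/= mulVf ?normr_eq0//.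
exact: scale1r.
Qed.

(** Rank one operators span a dense subspace. For an operator with range in the
    span of [n + 1] vectors, subtracting one rank one operator leaves an
    operator with range in the span of [n] vectors. *)
Lemma functional_rank1_eq0 (d : bop (aop X Y) R^o) :
  (forall f y, d (rank1 f y) = 0) -> d = 0.
Proof.
move=> d0.
have dfin n : forall (v : 'I_n -> Y) (T : aop X Y),
    (forall x, exists a : 'I_n -> R, T x = \sum_(i < n) a i *: v i) -> d T = 0.
  elim: n => [|n IHn] v T Tv.
    suff -> : T = 0 by rewrite linear0.
    by apply: aopP => x; have [a ->] := Tv x; rewrite big_ord0.
  (* [z |-> z - g z v] maps the span into that of the [n] shifted vectors *)
  have [g gE] := coordinate_functional (v ord_max).
  have [||h hE] := @bounded_bop R X (fun x => g (T x)) (`|g| * `|aop_bop T|).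
  - by move=> a x z; rewrite !linearP.
  - move=> x; apply: le_trans (dual_le_norm _ _) _.
    by rewrite -mulrA ler_wpM2l// le_normr_bop.
  have -> : d T = d (T - rank1 h (v ord_max)).
    by rewrite linearB /= d0 subr0.
  pose w i := v (widen_ord (leqnSn n) i).
  apply: (IHn (fun i => w i - (g (w i) : R) *: v ord_max)) => x.
  have [a Tx] := Tv x.
  exists (fun i => a (widen_ord (leqnSn n) i)).
  rewrite aopDE aopNE rank1E hE Tx linear_sum scaler_suml -sumrB big_ord_recr/=.
  rewrite dualZE -scalerA gE subrr addr0; apply: eq_bigr => i _.
  by rewrite dualZE scalerBr scalerA.
apply: bopP => T; apply/eqP; rewrite -normr_le0.
apply/ler_addgt0Pl => e e0; rewrite addr0.
have d1 : 0 < e / (`|d| + 1) by rewrite divr_gt0// ltr_wpDl.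
have /set_mem/(_ _ (nbhsx_ballx _ _ d1))[S [Sf TS]] := valP T.
pose S' : aop X Y := Aop (finite_rank_aop S Sf).
have dS : d S' = 0.
  case: (Sf) => n [v Sv]; apply: (dfin n v) => x.
  by apply: lin_span_range; apply: Sv; exists x.
have -> : d T = d (T - S') by rewrite linearB /= dS subr0.
rewrite (le_trans (le_normr_bop _ _))//.
move: TS; rewrite -ball_normE/= => /ltW TS.
rewrite (@le_trans _ _ (`|d| * (e / (`|d| + 1))))//; first by rewrite ler_wpM2l.
by rewrite mulrCA ler_piMr ?(ltW e0)// ler_pdivrMr ?ltr_wpDl// mul1r lerDl.
Qed.

End RankOne.

Section Operators.
Context {R : realType} {X Y : normedModType R} {Xp : set X} {Yp : set Y}.
Hypothesis Yw : wedge Yp.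

Lemma dual_wedge_wedge (Z : normedModType R) (Zp : set Z) :
  wedge (dual_wedge Zp).
Proof.
split; first by exists 0 => x _.
move=> a b f g a0 b0 fP gP x Zx; rewrite bopDE !bopZE.
by apply: addr_ge0; apply: mulr_ge0 => //; [exact: fP|exact: gP].
Qed.

Lemma aop_coneP (T : aop X Y) : aop_cone Xp Yp T <-> forall x, Xp x -> Yp (T x).
Proof.
split=> [TP x Xx|TP _ [x Xx <-]]; last exact: TP.
by apply: TP; exists x.
Qed.

Lemma aop_cone_wedge : wedge (aop_cone Xp Yp).
Proof.
split; first by exists 0; apply/aop_coneP => x _; exact: wedge0.
move=> a b S T a0 b0 /aop_coneP SP /aop_coneP TP; apply/aop_coneP => x Xx.
rewrite aopDE !aopZE; apply: wedgeD => //; apply: wedgeZ => //.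
  exact: SP.
exact: TP.
Qed.

Lemma aop_cone_rank1 f y :
  dual_wedge Xp f -> Yp y -> aop_cone Xp Yp (rank1 f y).
Proof.
move=> fP Yy; apply/aop_coneP => x Xx; rewrite rank1E.
by apply: wedgeZ => //; exact: fP.
Qed.

(** Since [x0'] is an order unit of the dual, it dominates a multiple of any
    functional norming [x]. *)
Lemma norm_le_interior (x0' : bop X R^o) : (dual_wedge Xp)° x0' ->
  exists2 M : R, 0 < M & forall x, Xp x -> `|x| <= M * (x0' x : R).
Proof.
move=> x0i.
have [M M0 XM] := interior_order_unit _ _ _ (dual_wedge_wedge X Xp) x0i.
exists M => // x Xx; have [f [fx f1]] := norming_functional X x.
have := XM f x Xx; rewrite bopDE bopZE subr_ge0 -fx => /le_trans; apply.
rewrite /GRing.scale/= ler_wpM2r//; first exact: (interior_subset x0i) Xx.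
by rewrite ler_piMr// ltW.
Qed.

Lemma rank1_order_unit (x0' : bop X R^o) (y0 : Y) :
  (dual_wedge Xp)° x0' -> Yp° y0 ->
  exists2 M : R, 0 < M &
    forall T, aop_cone Xp Yp ((M * `|T|) *: rank1 x0' y0 - T).
Proof.
move=> /norm_le_interior[M M0 XM] y0i.
have [N N0 YN] := interior_order_unit _ _ _ Yw y0i.
have Yy0 : Yp y0 by exact: interior_subset.
exists (N * M) => [|T]; first exact: mulr_gt0.
apply/aop_coneP => x /XM normx; rewrite aopDE aopNE aopZE rank1E.
rewrite scalerA -[X in X *: y0](subrK (N * `|T x|)) scalerDl -addrA.
apply: wedgeD => //; apply: wedgeZ => //; rewrite subr_ge0.
rewrite -!mulrA ler_wpM2l ?(ltW N0)// mulrCA.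
by rewrite (le_trans (le_normr_bop _ _))// ler_wpM2l.
Qed.

(** A functional below [y' (x) x] is tested on [f (x) y] in one variable at a
    time. For fixed [f >= 0], extremality of [y'] makes it a multiple of [y'] in
    [y]; evaluating at [y0] recovers that multiple as a positive functional of
    [f] below [x], and this is where [x] must be extremal in the bidual. Every
    [f] is a difference of positive ones because [x0'] is an order unit. *)
Lemma extremal_tensor (x0' : bop X R^o) (y0 : Y) (y' : bop Y R^o) (x : X)
    (psi : bop (aop X Y) R^o) :
  (dual_wedge Xp)° x0' -> Yp y0 -> (y' y0 : R) != 0 ->
  extremal (dual_wedge (dual_wedge Xp)) (bidual_emb x) ->
  extremal (dual_wedge Yp) y' ->
  (forall T, aop_cone Xp Yp T -> 0 <= (psi T : R) <= y' (T x)) ->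
  exists c : R, psi = c *: tensor y' x.
Proof.
move=> x0i Yy0 y'y0 xext y'ext psiP.
have y'y0_ge0 : 0 <= (y' y0 : R) by case: y'ext => + _; apply.
have [||A AE] :=
    @bounded_bop R (bop X R^o) (fun f => psi (rank1 f y0)) (`|psi| * `|y0|).
- by move=> a f g; rewrite rank1_linearl linearP.
- move=> f; apply: le_trans (dual_le_norm _ _) _.
  by rewrite -mulrA ler_wpM2l// mulrC norm_rank1.
have [c Ac] : exists c : R, A = c *: bidual_emb x.
  apply: (extremal_le (dual_wedge_wedge _ _) (y' y0) _ _ xext y'y0_ge0).
    move=> f fP; rewrite AE.
    by have /psiP/andP[] := aop_cone_rank1 f y0 fP Yy0.
  move=> f fP; have /psiP/andP[_] := aop_cone_rank1 f y0 fP Yy0.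
  rewrite rank1E dualZE => psile; suff : 0 <= y' y0 * f x - A f :> R by [].
  by rewrite AE subr_ge0 mulrC.
have pos f y : dual_wedge Xp f -> psi (rank1 f y) = (c / y' y0 * (f x * y' y)).
  move=> fP.
  have [||G GE] := @bounded_bop R Y (fun y => psi (rank1 f y)) (`|psi| * `|f|).
  - by move=> a z w; rewrite rank1_linearr linearP.
  - move=> z; apply: le_trans (dual_le_norm _ _) _.
    by rewrite -mulrA ler_wpM2l// norm_rank1.
  have [a Ga] : exists a : R, G = a *: y'.
    apply: (extremal_le (dual_wedge_wedge _ _) (f x) _ _ y'ext).
    - by case: xext => + _; exact.
    - by move=> z Yz; rewrite GE; have /psiP/andP[] := aop_cone_rank1 f z fP Yz.
    - move=> z Yz; have /psiP/andP[_] := aop_cone_rank1 f z fP Yz.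
      rewrite rank1E dualZE => psile; suff : 0 <= f x * y' z - G z :> R by [].
      by rewrite GE subr_ge0.
  have aE : a * y' y0 = c * f x :> R.
    have <- : G y0 = a * y' y0 :> R by rewrite Ga.
    by rewrite GE -AE Ac.
  have -> : psi (rank1 f y) = a * y' y :> R by rewrite -GE Ga.
  have -> : a = c * f x / y' y0 :> R by rewrite -aE mulfK.
  by field.
exists (c / y' y0); apply/eqP; rewrite -subr_eq0; apply/eqP.
apply: functional_rank1_eq0 => f y.
have [M M0 /(_ f) XM] := interior_order_unit _ _ _ (dual_wedge_wedge X Xp) x0i.
have x0P : dual_wedge Xp ((M * `|f|) *: x0').
  apply: (wedgeZ (dual_wedge_wedge X Xp)); first by rewrite mulr_ge0 ?(ltW M0).
  exact: interior_subset x0i.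
have := pos _ y XM; have := pos _ y x0P; set p := (M * _) *: _ => pE qE.
have fE : f = -1 *: (p - f) + p by rewrite scaleN1r opprB subrK.
have rE : psi (rank1 f y) = -1 * psi (rank1 (p - f) y) + psi (rank1 p y) :> R.
  by rewrite {1}fE rank1_linearl; exact: linearP.
suff : psi (rank1 f y) - c / y' y0 * y' (rank1 f y x) = 0 :> R by [].
rewrite rank1E dualZE rE pE qE.
have -> : (p - f) x = p x - f x :> R by [].
by ring.
Qed.
End Operators.

(** * The weak-* topology and continuous functions on compact sets *)

Section WeakStar.
Context {R : realType} {V : normedModType R}.

Lemma cvg_initial (S : choiceType) (T : topologicalType) (f : S -> T)
    (F : set_system S) (s : S) : Filter F ->
  f @ F --> f s -> F --> (s : initial_topology f).
Proof.
move=> FF fFs A /= [_ [[B Bo <-] Bfs BA]].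
apply: (filterS BA); apply: fFs.
exact: open_nbhs_nbhs.
Qed.

Lemma weakstar_eval_continuous (T : V) :
  continuous (fun f : weakstar V => (f : bop V R^o) T : R^o).
Proof.
move=> f; pose val_ptws (g : weakstar V) : {ptws V -> R^o} := bop_fun g.
apply: (@continuous_comp _ _ _ val_ptws (proj T)).
  exact: initial_continuous.
exact: (@proj_continuous V (fun=> R^o) T).
Qed.

Lemma weakstar_cvg (F : set_system (weakstar V)) (f : weakstar V) : Filter F ->
  (forall T : V, (fun g : weakstar V => (g : bop V R^o) T : R^o) @ F -->
    (f : bop V R^o) T) ->
  F --> f.
Proof.
move=> FF Ff; apply: cvg_initial.
by apply/cvg_sup => T; apply: cvg_initial; exact: Ff.
Qed.

Lemma weakstar_sub_cvg (A : set (weakstar V)) (F : set_system A) (f : A) :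
  Filter F ->
  (forall T : V, (fun g : A => (\val g : bop V R^o) T : R^o) @ F -->
    (\val f : bop V R^o) T) ->
  F --> f.
Proof.
move=> FF Ff; apply: (@cvg_initial _ _ (\val : A -> weakstar V)).
by apply: weakstar_cvg => T; exact: Ff.
Qed.

Lemma closure_eval (A : set (weakstar V)) (D : set R^o) (T : V) : closed D ->
  (forall f : weakstar V, A f -> D ((f : bop V R^o) T)) ->
  forall f : weakstar V, closure A f -> D ((f : bop V R^o) T).
Proof.
move=> Dc AD f Af; apply: Dc => B /weakstar_eval_continuous fB.
by have [g [Ag gB]] := Af _ fB; exists (g T); split=> //; exact: AD.
Qed.

Lemma ultra_compact_cvg (I : Type) (U : topologicalType) (F : set_system I)
    (h : I -> U) (K : set U) : UltraFilter F -> compact K ->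
  (forall i, K (h i)) -> exists2 p, K p & h @ F --> p.
Proof.
move=> FU Kc Kh; have [|p [Kp hp]] := Kc (h @ F) _.
  exact: (filterS (fun i _ => Kh i) filterT).
exists p => // B Bp; have [//|FNB] := in_ultra_setVsetC (h @^-1` B) FU.
by have [q []] := hp (~` B) B FNB Bp.
Qed.

(** Banach-Alaoglu: along an ultrafilter, the values at each [T] converge in a
    bounded interval, and the limits form a bounded linear functional. It is
    stated for [A] as a space of its own, since that is where the continuous
    functions live. *)
Lemma weakstar_compact (A : set (weakstar V)) (C : R) : closed A ->
  (forall (f : weakstar V) T, A f -> `|(f : bop V R^o) T| <= C * `|T|) ->
  compact [set: A].
Proof.
move=> Ac AC; rewrite compact_ultra => F FU _.
pose ev (T : V) (g : A) : R^o := (\val g : bop V R^o) T.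
have /choice[p pP] : forall T, exists p : R^o,
    p \in `[- (C * `|T|), C * `|T|] /\ ev T @ F --> p.
  move=> T; have [||p pT Fp] := @ultra_compact_cvg A R^o F (ev T)
    `[- (C * `|T|), C * `|T|] _ _ _.
  - exact: segment_compact.
  - by move=> g; rewrite /= in_itv/= -ler_norml; apply: AC; exact: set_valP.
  by exists p.
have pL : linear p.
  move=> a S T; apply: (@cvg_unique _ _ (ev (a *: S + T) @ F)) => //.
    by have [] := pP (a *: S + T).
  have -> : ev (a *: S + T) = (fun g => a *: ev S g + ev T g).
    by apply/funext => g; rewrite /ev linearP.
  by apply: cvgD; [apply: cvgZl_tmp|]; have [] := pP T; have [] := pP S.
have [|f fE] := @bounded_bop R V p C pL.
  by move=> T; have [+ _] := pP T; rewrite in_itv/= => /andP[].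
have Fval : \val @ F --> (f : weakstar V).
  by apply: weakstar_cvg => T; rewrite fE; have [] := pP T.
have Af : A f.
  by apply: (closed_cvg A Ac _ _ Fval); apply: nearW => g; exact: set_valP.
exists (exist _ f (mem_set Af)); split=> //.
by apply: weakstar_sub_cvg => T /=; rewrite fE; have [] := pP T.
Qed.

End WeakStar.

Section ContinuousFunctions.
Context {R : realType} {K : topologicalType}.
Local Notation CK := (continuousType K R^o).

Lemma compact_cts_le (w : CK) : compact [set: K] ->
  exists2 B : R, 0 <= B & forall k, w k <= B.
Proof.
move=> Kc; have /compact_bounded : compact (w @` [set: K]).
  apply: continuous_compact => //; apply: continuous_subspaceT.
  exact: cts_fun.
move=> [M [_ MB]].
exists (`|M| + 1) => [|k]; first by rewrite addr_ge0.
apply: le_trans (ler_norm _) _; apply: (MB (`|M| + 1)); last by exists k.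
by rewrite ltr_pwDr// ler_norm.
Qed.

Lemma cts_cone_cone : cone (@cts_cone R K).
Proof.
split; first split.
- by exists 0 => k /=.
- move=> a b f g a0 b0 f0 g0 k; change (0 <= a * f k + b * g k :> R).
  by rewrite addr_ge0// mulr_ge0.
- apply/seteqP; split=> [f [f0 [g g0 gf]]|_ ->].
    apply/continuousEP => k; apply/eqP; rewrite eq_le; apply/andP; split=> //.
    have := g0 k; rewrite -gf; change (0 <= g k -> - g k <= 0 :> R).
    by rewrite oppr_le0.
  by split=> [k|]; [exact: lexx|exists 0 => [k|]; [exact: lexx|rewrite oppr0]].
Qed.

Lemma cts_max_subproof (f g : CK) :
  continuous (fun k => Num.max (f k) (g k) : R^o).
Proof.
by move=> k; apply: (@continuous_max R K f g); exact: cts_fun.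
Qed.

Lemma cts_mul_subproof (f g : CK) : continuous (fun k => (f k : R) * g k : R^o).
Proof. by move=> k; apply: cvgM; exact: cts_fun. Qed.
Definition cts_max f g : CK := mkcts (cts_max_subproof f g).
Definition cts_mul f g : CK := mkcts (cts_mul_subproof f g).

Lemma cts_lattice : vector_lattice (@cts_cone R K).
Proof.
split=> [|f g]; first exact: cts_cone_cone.
exists (cts_max f g); split=> [h|h fgh].
  move=> fgh k; change (0 <= Num.max (f k : R) (g k) - h k).
  by rewrite subr_ge0 le_max; case: fgh => ->; rewrite lexx ?orbT.
move=> k; change (0 <= h k - Num.max (f k : R) (g k)).
rewrite subr_ge0 ge_max.
by apply/andP; split; rewrite -subr_ge0; apply: (fgh _ _ k); [left|right].
Qed.
End ContinuousFunctions.

(** * The cover theorem for a set of extremal states *)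

Section Cover.
Context {R : realType} {X Y : normedModType R}.
Local Notation V := (aop X Y).
Context (P : set V) (u : V) (M : R) (S : set (weakstar V)).
Hypotheses (Pc : cone P) (M0 : 0 < M).
Hypothesis Pu : forall T, P ((M * `|T|) *: u - T).
Hypothesis S_ge0 : forall f : weakstar V, S f -> forall T, P T ->
  0 <= ((f : bop V R^o) T : R).
Hypothesis S1 : forall f : weakstar V, S f -> (f : bop V R^o) u = 1 :> R.
Hypothesis S_sep : forall T,
  (forall f : weakstar V, S f -> 0 <= ((f : bop V R^o) T : R)) -> P T.
Hypothesis S_ext : forall f : weakstar V, S f -> forall psi : bop V R^o,
  (forall T, P T -> 0 <= (psi T : R) <= (f : bop V R^o) T) ->
  exists c : R, psi = c *: (f : bop V R^o).

Local Notation K := (closure S).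
Local Notation CK := (continuousType K R^o).
Implicit Types (w v f g h : CK) (T U : V) (k : K).
Let val (k : K) : bop V R^o := \val k.
Let ev (T : V) : CK := eval_on K T.

Let Pw : wedge P. Proof. by case: Pc. Qed.

Let evE T k : ev T k = val k T. Proof. by []. Qed.

Let evZ a T k : ev (a *: T) k = a * ev T k :> R.
Proof. by rewrite !evE dualZE. Qed.

Let evB T U k : ev (T - U) k = (ev T k : R) - ev U k :> R.
Proof. by rewrite !evE linearB. Qed.

Let ev_linear : linear ev.
Proof. by move=> a T U; apply/continuousEP => k; rewrite evE linearP. Qed.

Let ev_ge0 T k : P T -> 0 <= (ev T k : R).
Proof.
move=> PT; apply: (closure_eval S [set r : R^o | 0 <= r] T _ _ (\val k)).
- exact: closed_ge.
- by move=> f Sf; exact: S_ge0.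
- exact: set_valP.
Qed.

Let ev1 k : ev u k = 1 :> R.
Proof.
apply: (closure_eval S [set r : R^o | r = 1] u _ _ (\val k)).
- exact: closed_eq.
- by move=> f Sf; exact: S1.
- exact: set_valP.
Qed.

Let ev_le T k : (ev T k : R) <= M * `|T|.
Proof.
have := ev_ge0 _ k (Pu T).
have -> : ev ((M * `|T|) *: u - T) k = M * `|T| * ev u k - ev T k :> R.
  by rewrite !evE linearB linearZ.
by rewrite ev1 mulr1 subr_ge0.
Qed.

Let K_compact : compact [set: K].
Proof.
apply: (weakstar_compact K M); first exact: closed_closure.
move=> f T Kf; pose k : K := exist _ f (mem_set Kf).
apply/ler_normlP; split; last exact: (ev_le T k).
by have := ev_le (- T) k; rewrite normrN evE linearN.
Qed.

Section Envelope.
Variable k0 : K.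
Hypothesis Sk0 : S (\val k0).

Let env (w : CK) : R :=
  inf [set r : R | exists2 T, (forall k, w k <= ev T k :> R) & r = ev T k0].

Let env_le w T : (forall k, w k <= ev T k :> R) -> env w <= ev T k0.
Proof.
move=> wT; apply: ge_inf; last by exists T.
by exists (w k0) => _ [U wU ->].
Qed.

Let le_env w b :
  (forall T, (forall k, w k <= ev T k :> R) -> b <= ev T k0 :> R) -> b <= env w.
Proof.
move=> H; apply: lb_le_inf; last by move=> _ [T wT ->]; exact: H.
have [B B0 wB] := compact_cts_le w K_compact.
exists (ev (B *: u) k0), (B *: u) => // k.
by rewrite evZ ev1 mulr1.
Qed.

Let env_sublinear : sublinear env.
Proof.
split=> [w v|a w].
  rewrite -lerBlDr; apply: le_env => T wT.
  rewrite lerBlDr -lerBlDl; apply: le_env => U vU.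
  rewrite lerBlDl.
  have -> : ev T k0 + ev U k0 = ev (T + U) k0 by rewrite !evE linearD.
  apply: env_le => k; rewrite evE linearD; exact: lerD (wT k) (vU k).
rewrite le_eqVlt => /predU1P[<-|a0].
  rewrite scale0r mul0r; have -> : 0 = ev 0 k0 :> R by rewrite evE linear0.
  by apply: env_le => k; rewrite evE linear0.
rewrite -ler_pdivrMl//; apply: le_env => T wT; rewrite ler_pdivrMl//.
have -> : a * ev T k0 = ev (a *: T) k0 by rewrite !evE dualZE.
apply: env_le => k; rewrite evE dualZE; exact: (ler_wpM2l (ltW a0) (wT k)).
Qed.

Section RepresentingFunctional.
Variable mu : CK -> R.
Hypothesis mu_dom : dominated env mu.

Let muD f g : mu (f + g) = mu f + mu g.
Proof. by have [mL _] := mu_dom; have := mL 1 f g; rewrite !scale1r. Qed.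

Let muN f : mu (- f) = - mu f.
Proof. by have [mL _] := mu_dom; exact: linear_funN. Qed.

Let mu0 : mu 0 = 0.
Proof. by apply: (@addrI _ (mu 0)); rewrite -muD !addr0. Qed.

Let muZ a f : mu (a *: f) = a * mu f.
Proof. by have [mL _] := mu_dom; have := mL a f 0; rewrite addr0 mu0 addr0. Qed.

Let mu_le f T : (forall k, f k <= ev T k :> R) -> mu f <= ev T k0.
Proof.
by move=> fT; have [_ me] := mu_dom; exact: le_trans (me f) (env_le _ _ fT).
Qed.

Let mu_ge0 f : (forall k, 0 <= f k :> R) -> 0 <= mu f.
Proof.
move=> f0; rewrite -oppr_le0 -muN.
have -> : 0 = ev 0 k0 :> R by rewrite evE linear0.
apply: mu_le => k; rewrite evE linear0.
by change (- (f k : R) <= 0); rewrite oppr_le0.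
Qed.

Let mu_ev T : mu (ev T) = ev T k0.
Proof.
apply/eqP; rewrite eq_le mu_le//=.
have : mu (ev (- T)) <= ev (- T) k0 by apply: mu_le.
rewrite evE linearN.
have -> : ev (- T) = - ev T by apply/continuousEP => k; rewrite evE linearN.
by rewrite muN lerN2.
Qed.

Let mul_linear f : linear (cts_mul f).
Proof.
move=> a g h; apply/continuousEP => k.
change ((f k : R) * (a * g k + h k) = a * (f k * g k) + f k * h k).
by ring.
Qed.

Let mulC f g : cts_mul f g = cts_mul g f :> CK.
Proof. by apply/continuousEP => k; exact: mulrC. Qed.

(* Extremality enters here: weighting [mu] by [U], with values in [0, 1], gives
   a functional whose restriction to [V] lies between 0 and the extremal one. *)
Let mu_mul_unit U T : P U -> P (u - U) ->
  mu (cts_mul (ev U) (ev T)) = ev U k0 * ev T k0 :> R.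
Proof.
move=> PU PuU.
have U1 k : (ev U k : R) <= 1.
  have := ev_ge0 _ k PuU; have -> : ev (u - U) k = ev u k - ev U k :> R.
    by rewrite !evE linearB.
  by rewrite ev1 subr_ge0.
have [||psi psiE] := @bounded_bop R V (fun T => mu (cts_mul (ev U) (ev T))) M.
- by move=> a T' U'; rewrite ev_linear mul_linear muD muZ.
- move=> T'; have -> : M * `|T'| = ev ((M * `|T'|) *: u) k0 :> R.
    by rewrite evZ ev1 mulr1.
  apply: mu_le => k; rewrite [leRHS]evZ ev1 mulr1.
  change ((ev U k : R) * ev T' k <= M * `|T'|).
  have U0 := ev_ge0 _ k PU.
  apply: (@le_trans _ _ ((ev U k : R) * (M * `|T'|))).
    by apply: ler_wpM2l => //; exact: ev_le.
  by rewrite ler_piMl// mulr_ge0// ltW.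
have [T' PT'|c psic] := S_ext (\val k0) Sk0 psi.
  apply/andP; split.
    rewrite psiE; apply: mu_ge0 => k.
    change (0 <= (ev U k : R) * ev T' k).
    by rewrite mulr_ge0// ev_ge0.
  rewrite psiE; apply: mu_le => k.
  change ((ev U k : R) * ev T' k <= ev T' k).
  by rewrite ler_piMl// ev_ge0.
have psicE T' : psi T' = c * ev T' k0 :> R by rewrite psic.
have cE : c = ev U k0.
  have := psicE u; rewrite ev1 mulr1 psiE => <-; rewrite -mu_ev; congr mu.
  apply/continuousEP => k; change ((ev U k : R) * ev u k = ev U k).
  by rewrite ev1 mulr1.
by rewrite -psiE psicE cE.
Qed.

(* A general [U] is an affine combination of [u] and an element between 0 and
   [u], so multiplicativity extends by linearity. *)
Let mu_mul U T : mu (cts_mul (ev U) (ev T)) = ev U k0 * ev T k0 :> R.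
Proof.
have Pu1 : P u by apply: S_sep => f Sf; rewrite S1.
have [N N0 [PN PNN]] : exists2 N : R, 0 < N & P (N *: u - U) /\ P (N *: u + U).
  exists (M * `|U| + 1); first by rewrite ltr_wpDl// mulr_ge0// ltW.
  rewrite scalerDl scale1r; split; rewrite addrAC; apply: wedgeD => //.
  by rewrite -[X in _ + X]opprK -normrN.
have [U1 UE UE'] : exists2 U1, U + N *: u = (2 * N) *: U1 &
    N *: u - U = (2 * N) *: (u - U1).
  have NN : 2 * N != 0 by rewrite mulf_neq0 ?gt_eqF.
  exists ((2 * N)^-1 *: (U + N *: u)); first by rewrite scalerA mulfV ?scale1r.
  rewrite scalerBr scalerA mulfV// scale1r mulr_natl mulr2n scalerDl.
  by rewrite opprD addrACA subrr addr0 addrC.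
have U1E : U = (2 * N) *: U1 - N *: u by rewrite -UE addrK.
have PU1 : P U1.
  by apply: (wedgeZ_gt0 Pw (2 * N)); rewrite ?mulr_gt0// -UE addrC.
have PuU1 : P (u - U1).
  by apply: (wedgeZ_gt0 Pw (2 * N)); rewrite ?mulr_gt0// -UE'.
have evU : ev U = (2 * N) *: ev U1 + (- N) *: ev u.
  apply/continuousEP => k.
  change (ev U k = 2 * N * ev U1 k + - N * ev u k :> R).
  by rewrite {1}U1E evB !evZ; ring.
have mu_u : cts_mul (ev T) ((- N) *: ev u) = (- N) *: ev T :> CK.
  apply/continuousEP => k.
  change ((ev T k : R) * (- N * ev u k) = - N * ev T k).
  by rewrite ev1; ring.
rewrite evU mulC mul_linear muD muZ mu_u muZ mu_ev (mulC (ev T)) mu_mul_unit//.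
change (2 * N * (ev U1 k0 * ev T k0) + - N * ev T k0 =
  (2 * N * ev U1 k0 + - N * ev u k0) * ev T k0 :> R).
by rewrite ev1; ring.
Qed.

(* The function [h] certifies that [A] has full measure for a measure
   representing [mu]. These sets form a filter, and its convergence to [k0]
   says that [mu] is concentrated at [k0]. *)
Let conull : set_system K := [set A | exists h : CK,
  [/\ forall k, 0 <= h k :> R, forall k, ~ A k -> 1 <= h k :> R & mu h <= 0]].

Let conull_filter : Filter conull.
Proof.
split.
- by exists 0; split=> [k|k|]; [exact: lexx|move=> /(_ I)|rewrite mu0].
- move=> A B [f [f0 f1 fm]] [g [g0 g1 gm]]; exists (f + g); split=> [k|k AB|].
  + by change (0 <= (f k : R) + g k); rewrite addr_ge0.
  + change (1 <= (f k : R) + g k).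
    have [Ak|/f1 fk] := pselect (A k); last by rewrite ler_wpDr.
    have [Bk|/g1 gk] := pselect (B k); last by rewrite ler_wpDl.
    by case: AB.
  + by rewrite muD; lra.
- move=> A B AB [f [f0 f1 fm]]; exists f; split=> // k NB.
  by apply: f1 => /AB.
Qed.

(* Only pointwise convergence is to be checked, and the square of [T - k0 T]
   serves as test function at [T]. *)
Let conull_cvg : conull --> k0.
Proof.
apply: (@weakstar_sub_cvg _ _ _ _ _ conull_filter) => T B.
move=> /nbhs_normP[e /= e0 eB].
pose U := e^-1 *: (T - (ev T k0 : R) *: u).
have evU k : ev U k = e^-1 * (ev T k - ev T k0) :> R.
  have -> : ev U k = e^-1 * (ev T k - ev T k0 * ev u k) :> R.
    by rewrite /U evZ evB evZ.
  by rewrite ev1 mulr1.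
exists (cts_mul (ev U) (ev U)); split=> [k|k NB|].
- by change (0 <= (ev U k : R) * ev U k); rewrite -expr2 sqr_ge0.
- change (1 <= (ev U k : R) * ev U k); rewrite -expr2 -real_normK ?num_real//.
  rewrite expr_ge1// evU normrM gtr0_norm ?invr_gt0// ler_pdivlMl// mulr1.
  rewrite leNgt; apply/negP => Te; apply: NB; apply: eB => /=.
  by rewrite distrC.
- by rewrite mu_mul evU subrr mulr0 mul0r.
Qed.

Lemma representing_functional_eval w : mu w <= w k0 :> R.
Proof.
apply/ler_addgt0Pr => e e0; pose r : R := w k0 + e.
have /conull_cvg[h [h0 h1 hm]] : nbhs k0 [set k | w k < r :> R].
  have wC : continuous w by exact: cts_fun.
  apply: (wC k0 [set s : R^o | s < r]); apply: open_nbhs_nbhs.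
  by split; [exact: open_lt|rewrite /= ltrDl].
have [B B0 wB] := compact_cts_le w K_compact.
(* off the neighbourhood, [w - r <= C <= C * h] *)
pose C := B + `|r|; have C0 : 0 <= C by rewrite addr_ge0.
have -> : mu w = mu (w - C *: h) + C * mu h by rewrite -muZ -muD subrK.
have Ch : C * mu h <= 0 by rewrite mulr_ge0_le0.
suff : mu (w - C *: h) <= r by rewrite -/r; lra.
have -> : r = ev (r *: u) k0 by rewrite evZ ev1 mulr1.
apply: mu_le => k; rewrite [leRHS]evZ ev1 mulr1.
change ((w k : R) - C * h k <= r).
have [wk|/h1 hk] := pselect ((w k : R) < r).
  by have := mulr_ge0 C0 (h0 k); lra.
have : C <= C * h k by rewrite ler_peMr.
have := wB k; have := ler_norm (- r); rewrite normrN /C; lra.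
Qed.
End RepresentingFunctional.

(** An upper bound of [w] by elements of [V] can be made arbitrarily tight at a
    point [k0] of [S]. *)
Lemma envelope_le w b :
  (forall T, (forall k, w k <= ev T k :> R) -> b <= ev T k0 :> R) ->
  b <= w k0 :> R.
Proof.
move=> H; have [mu [mu_dom mu_w _]] := extreme_dominated _ w env_sublinear.
apply: le_trans (representing_functional_eval mu mu_dom w).
by rewrite mu_w; exact: le_env.
Qed.
End Envelope.

Let S_dense f k : (forall k, S (\val k) -> 0 <= f k :> R) -> 0 <= f k :> R.
Proof.
move=> fS.
have fC : continuous f by exact: cts_fun.
apply: (@closed_ge R 0) => B /(fC k)[_ [[D Do <-] Dk] DB].
have [g [Sg Dg]] := set_valP k D (open_nbhs_nbhs (conj Do Dk)).
pose j : K := exist _ g (mem_set (subset_closure Sg)).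
by exists (f j); split; [exact: fS|exact: (DB j Dg)].
Qed.

(** [S] being dense in its closure, a lower bound of the elements of [V] above
    [w] only has to be compared with [w] on [S], where envelope_le applies. *)
Lemma closure_extremal_states_cover :
  vector_lattice_cover P (@cts_cone R K) (@eval_on R X Y K).
Proof.
split=> //; first exact: cts_lattice.
  move=> T; split=> [PT k|evT]; first exact: ev_ge0.
  apply: S_sep => f Sf.
  exact: (evT (exist _ f (mem_set (subset_closure Sf)))).
move=> w; split=> [f [_ wf]|l lw]; first exact: wf.
move=> k; apply: S_dense => {}k Sk.
change (0 <= (w k : R) - l k); rewrite subr_ge0.
apply: envelope_le => // T wT.
have : cts_cone (ev T - l).
  apply: lw; split; first by exists T.
  by move=> k'; change (0 <= (ev T k' : R) - w k'); rewrite subr_ge0.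
by move=> /(_ k) H; rewrite -subr_ge0.
Qed.
End Cover.

(** * The cover of the approximable operators *)

Section Positivity.
Context {R : realType} {X Y : normedModType R} {Xp : set X} {Yp : set Y}.

Lemma bop_closure (T : bop X Y) (A : set X) (D : set Y) : closed D ->
  (forall x, A x -> D (T x)) -> forall x, closure A x -> D (T x).
Proof.
move=> Dc AD x Ax; apply: Dc => B /nbhs_normP[e /= e0 eB].
have d0 : 0 < e / (`|T| + 1) by rewrite divr_gt0// ltr_wpDl.
have [z [Az xz]] := Ax _ (nbhsx_ballx x _ d0).
exists (T z); split; [exact: AD|apply: eB => /=].
rewrite -linearB (le_lt_trans (le_normr_bop _ _))//.
move: xz; rewrite -ball_normE/= ltr_pdivlMr ?ltr_wpDl// mulrDr mulr1 mulrC.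
by apply: le_lt_trans; rewrite lerDl.
Qed.

Lemma aop_cone_cone : cone Yp -> total_cone Xp ->
  cone (aop_cone Xp Yp).
Proof.
move=> [Yw YN] Xtot; split; first exact: aop_cone_wedge.
apply/seteqP; split=> [T [/aop_coneP TP [U /aop_coneP UP UT]]|_ ->]; last first.
  split; first exact: wedge0 (aop_cone_wedge Yw).
  by exists 0; [exact: wedge0 (aop_cone_wedge Yw)|rewrite oppr0].
have TX x : Xp x -> T x = 0.
  move=> Xx; suff : (Yp `&` [set - y | y in Yp]) (T x) by rewrite YN.
  by split; [exact: TP|exists (U x); [exact: UP|rewrite -UT]].
apply: aopP => x.
apply: (@bop_closure T (lin_span Xp) [set 0]).
- apply: accessible_closed_set1; apply: hausdorff_accessible.
  exact: norm_hausdorff.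
- move=> _ [n [a [v [Xv ->]]]].
  rewrite /= linear_sum big1// => i _.
  by rewrite linearZ /= TX// scaler0.
- move=> B; rewrite nbhsE => -[W [Wo Wx] WB].
  have [z [Wz Az]] := Xtot W (ex_intro _ x Wx) Wo.
  by exists z; split=> //; exact: WB.
Qed.

(** A nonzero extremal [x] is rescaled so that a separating [y'], normalised at
    [y0], gives an element [y' (x) x] of [S']. *)
Lemma Sprime_separates (y0 : Y) (x0' : bop X R^o) (T : aop X Y) :
  Xp `<=` closure (conv_hull [set x | extremal Xp x]) -> wedge Xp ->
  wedge Yp -> closed Yp ->
  Yp° y0 -> (dual_wedge Xp)° x0' ->
  (forall f : weakstar (aop X Y), Sprime Xp Yp y0 x0' f ->
    0 <= ((f : bop (aop X Y) R^o) T : R)) ->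
  aop_cone Xp Yp T.
Proof.
move=> Xd Xw Yw Yc y0i x0i TS; apply/aop_coneP => x /Xd.
apply: bop_closure => // _ [n [a [v [a0 _ vext ->]]]].
rewrite linear_sum; under eq_bigr do rewrite linearZ.
apply: wedge_sum => // i; have {}vext := vext i.
have [->|vi0] := eqVneq (v i) 0; first by rewrite linear0; exact: wedge0.
have [//|NY] := pselect (Yp (T (v i))).
have [f [fext f1 fneg]] := extremal_separation _ _ _ _ Yw Yc y0i NY.
have xv : 0 < (x0' (v i) : R).
  have [M M0 /(_ (v i)) MX] := norm_le_interior x0' x0i.
  have : 0 < `|v i| by rewrite normr_gt0.
  by move=> /lt_le_trans/(_ (MX _)); rewrite pmulr_rgt0//; apply; case: vext.
have : 0 <= f (T ((x0' (v i) : R)^-1 *: v i)) :> R.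
  apply: (TS (tensor f ((x0' (v i) : R)^-1 *: v i))).
  exists f, ((x0' (v i) : R)^-1 *: v i); split=> //.
    by apply: extremalZ => //; rewrite invr_gt0.
  by rewrite f1 mul1r dualZE mulVf// gt_eqF.
by rewrite linearZ dualZE pmulr_rge0 ?invr_gt0// leNgt fneg.
Qed.
End Positivity.

Theorem theorem6p1 (R : realType) (X Y : normedModType R)
    (Xp : set X) (Yp : set Y)
    (X_neq0 : exists x : X, x != 0) (Y_neq0 : exists y : Y, y != 0)
    (Xp_cone : ordered_normed_space Xp) (Yp_cone : ordered_normed_space Yp)
    (Xp_total : total_cone Xp)
    (Xp_additive : exists N : X -> R, equivalent_norm N /\ additive_on Xp N)
    (Xp_extremal : forall x, extremal Xp x ->
       extremal (dual_wedge (dual_wedge Xp)) (bidual_emb x))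
    (Xp_dense : Xp `<=` closure (conv_hull [set x | extremal Xp x]))
    (Yp_interior : Yp° !=set0)
    (y0 : Y) (y0_interior : Yp° y0)
    (x0' : bop X R^o) (x0'_interior : (dual_wedge Xp)° x0') :
  vector_lattice_cover
    (aop_cone Xp Yp)
    (@cts_cone R (closure (Sprime Xp Yp y0 x0')))
    (@eval_on R X Y (closure (Sprime Xp Yp y0 x0'))).
Proof.
have [[Xw _] Xclosed] := Xp_cone; have [Yc Yclosed] := Yp_cone.
have [Yw _] := Yc; have Yy0 : Yp y0 by exact: interior_subset.
have [M M0 MP] := rank1_order_unit Yw x0' y0 x0'_interior y0_interior.
apply: (closure_extremal_states_cover _ (rank1 x0' y0) M) => //.
- exact: aop_cone_cone.
- move=> _ [y' [x [[Xx _] [y'P _] _ ->]]] T /aop_coneP TP.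
  exact: y'P (TP x Xx).
- move=> _ [y' [x [_ _ xy1 ->]]].
  change (y' (rank1 x0' y0 x) = 1 :> R).
  by rewrite rank1E dualZE mulrC.
- by move=> T; apply: Sprime_separates.
- move=> _ [y' [x [xext y'ext xy1 ->]]] psi psiP.
  apply: (extremal_tensor Yw x0' y0 y' x psi x0'_interior Yy0 _
    (Xp_extremal x xext) y'ext psiP).
  apply/eqP => y'0; move: xy1.
  by rewrite y'0 mul0r => /eqP; rewrite eq_sym oner_eq0.
Qed.
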